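(* Let $T$ be a tree with $n\ge1$ vertices and let $\ell\ge n$ be an integer. Then the vertices of the polytope $P_\ell(T)$ are exactly the near-minimally self-reachable configurations on $T$ with $\ell$ chips.
   Context: Label the vertices $v_1,\dots,v_n$; $e_i$ is the $i$th standard basis vector. A chip configuration on $T$ is a vector $c\in\mathbb{Z}_{\ge0}^n$ ($c_i$ chips on $v_i$). The Laplacian $\Delta(T)$ has $\Delta_{ii}=\deg(v_i)$, $\Delta_{ij}=-1$ if $v_iv_j$ is an edge, $0$ otherwise; firing $v_i$ from $c$ produces $c-\Delta(T)e_i$, legal if $c_i\ge\deg(v_i)$. A configuration is self-reachable on $T$ if some nonempty finite sequence of legal firings starting from it returns to it. (Known: equivalently, it has at least $m-1$ chips on every $m$-vertex subtree of $T$.) A minimally self-reachable configuration is a self-reachable one with exactly $n-1$ chips. A configuration $\nu$ is near-minimally self-reachable on $T$ if it is self-reachable and not minimally self-reachable, and there is a unique $i\in\{1,\dots,n\}$ such that $\nu-e_i$ is a self-reachable configuration on $T$; $\nu$ is then called near-minimally self-reachable about $v_i$. $S_\ell^{(T)}$ is the set of self-reachable configurations with exactly $\ell$ chips and $P_\ell(T)=\mathrm{conv}(S_\ell^{(T)})$. *)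

(* Defs.v *)
From mathcomp Require Import all_boot all_order all_algebra.
From mathcomp Require Import boolp classical_sets reals.

Set Implicit Arguments.
Unset Strict Implicit.
Unset Printing Implicit Defensive.

Import Order.TTheory GRing.Theory Num.Theory.

Local Open Scope classical_set_scope.
Local Open Scope ring_scope.

(* With [e] symmetric, any edge is a [ucycle] of size 2, so only the
   cycles of size at least 3 are excluded. *)
Definition is_tree (n : nat) (e : rel 'I_n) : Prop :=
  [/\ symmetric e, irreflexive e, (forall x y, connect e x y)
    & forall c : seq 'I_n, (2 < size c)%N -> ~ ucycle e c].

Definition deg (n : nat) (e : rel 'I_n) (i : 'I_n) : nat :=
  #|[set j | e i j]%SET|.

Definition laplacian (n : nat) (e : rel 'I_n) : 'M[int]_n :=
  \matrix_(i, j) (if i == j then (deg e i)%:Z else if e i j then -1 else 0).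

Definition basis_vec (n : nat) (i : 'I_n) : 'cV[int]_n := delta_mx i 0.

Definition is_config (n : nat) (c : 'cV[int]_n) : Prop :=
  forall i, 0 <= c i 0.

Definition chips (n : nat) (c : 'cV[int]_n) : int := \sum_i c i 0.

Definition fire (n : nat) (e : rel 'I_n) (c : 'cV[int]_n) (i : 'I_n) :
    'cV[int]_n :=
  c - laplacian e *m basis_vec i.

Definition legal (n : nat) (e : rel 'I_n) (c : 'cV[int]_n) (i : 'I_n) : bool :=
  (deg e i)%:Z <= c i 0.

Fixpoint legal_seq (n : nat) (e : rel 'I_n) (c : 'cV[int]_n)
    (s : seq 'I_n) : bool :=
  if s is i :: s' then legal e c i && legal_seq e (fire e c i) s' else true.

Definition self_reachable (n : nat) (e : rel 'I_n) (c : 'cV[int]_n) : Prop :=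
  is_config c /\
  exists s : seq 'I_n,
    [/\ s <> [::], legal_seq e c s & foldl (fire e) c s = c].

Definition minimally_self_reachable (n : nat) (e : rel 'I_n)
    (c : 'cV[int]_n) : Prop :=
  self_reachable e c /\ chips c = n%:Z - 1.

Definition near_minimally_self_reachable (n : nat) (e : rel 'I_n)
    (c : 'cV[int]_n) : Prop :=
  [/\ self_reachable e c, ~ minimally_self_reachable e c
    & exists! i : 'I_n, self_reachable e (c - basis_vec i)].

Definition real_config (R : realType) (n : nat) (c : 'cV[int]_n) : 'cV[R]_n :=
  map_mx intr c.

Arguments real_config R {n} c.

Definition conv_hull (R : realType) (n : nat) (S : set 'cV[R]_n) :
    set 'cV[R]_n :=
  [set x | exists (k : nat) (w : 'I_k -> R) (p : 'I_k -> 'cV[R]_n),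
    [/\ forall i, 0 <= w i, \sum_i w i = 1, forall i, S (p i)
      & x = \sum_i w i *: p i]].

(* A face of P is the set of points of P where some linear inequality
   valid on P is an equality; a vertex is a face consisting of one point. *)
Definition is_face (R : realType) (n : nat) (P F : set 'cV[R]_n) : Prop :=
  exists (a : 'rV[R]_n) (b : R),
    (forall x, P x -> (a *m x) 0 0 <= b) /\
    F = P `&` [set x | (a *m x) 0 0 = b].

Definition vertices (R : realType) (n : nat) (P : set 'cV[R]_n) :
    set 'cV[R]_n :=
  [set v | is_face P [set v]].

Definition self_reachable_with (n : nat) (e : rel 'I_n) (l : int) :
    set 'cV[int]_n :=
  [set c | self_reachable e c /\ chips c = l].

Definition self_reachable_polytope (R : realType) (n : nat) (e : rel 'I_n)
    (l : int) : set 'cV[R]_n :=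
  conv_hull (real_config R @` self_reachable_with e l).

Arguments self_reachable_polytope R {n} e l.

(* Main.v *)
Require Import Defs.
From mathcomp Require Import all_boot all_order all_algebra.
From mathcomp Require Import boolp classical_sets reals.
From mathcomp Require Import zify ring lra.

(* On a tree, a configuration is self-reachable iff it dominates the in-degree
   vector of some orientation: orient every edge towards the endpoint whose
   last firing comes first; conversely an orientation of a tree is acyclic, and
   firing every vertex once, sinks first, is legal.  As all orientations have
   the same total in-degree, at most n - 1, a near-minimal configuration about
   [v] is an in-degree vector plus chips that all sit on the sink [v].  It is the
   unique maximizer of a functional increasing along the orientation and largest
   at [v].  Conversely, if two different chips of a configuration can be removed,
   moving either one onto the place of the other exhibits the configuration as
   a midpoint. *)

Set Implicit Arguments.
Unset Strict Implicit.
Unset Printing Implicit Defensive.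

Import Order.TTheory GRing.Theory Num.Theory.

Local Open Scope classical_set_scope.
Local Open Scope ring_scope.

(** * Chip firing and the orientations it induces *)

Section Firing.

Variables (n : nat) (e : rel 'I_n).

Definition indeg (O : rel 'I_n) (v : 'I_n) : nat := (\sum_u O u v)%N.

(** [O u w] directs the edge from [u] to [w]. The sum of booleans gives each edge exactly one
    direction and each non-edge none. *)
Definition orientation (O : rel 'I_n) : Prop :=
  forall u w, (O u w + O w u)%N = e u w.

Lemma degE (v : 'I_n) : deg e v = (\sum_u e v u)%N.
Proof.
rewrite /deg -sum1_card big_mkcond /=; apply: eq_bigr => u _.
by rewrite inE; case: (e v u).
Qed.

Lemma fireE (c : 'cV[int]_n) (i j : 'I_n) :
  fire e c i j 0 = c j 0 - laplacian e j i.
Proof. by rewrite /fire /basis_vec -colE !mxE. Qed.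

Lemma foldl_fireE (c : 'cV[int]_n) (s : seq 'I_n) (j : 'I_n) :
  foldl (fire e) c s j 0 = c j 0 - \sum_(i <- s) laplacian e j i.
Proof.
elim: s c => [|i s IHs] c /=; first by rewrite big_nil subr0.
by rewrite IHs fireE big_cons opprD addrA.
Qed.

Lemma legal_seq_rcons (c : 'cV[int]_n) (s : seq 'I_n) (i : 'I_n) :
  legal_seq e c (rcons s i) =
  legal_seq e c s && legal e (foldl (fire e) c s) i.
Proof. by elim: s c => [|j s IHs] c /=; rewrite ?andbT // IHs andbA. Qed.

Lemma is_config_fire (c : 'cV[int]_n) (i : 'I_n) :
  is_config c -> legal e c i -> is_config (fire e c i).
Proof.
move=> c0 ci j; rewrite fireE mxE; have := c0 j; have := ci; rewrite /legal.
by case: eqVneq => [->|_]; [lia | case: (e j i); lia].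
Qed.

Lemma is_config_foldl_fire (c : 'cV[int]_n) (s : seq 'I_n) :
  is_config c -> legal_seq e c s -> is_config (foldl (fire e) c s).
Proof.
by elim: s c => //= i s IHs c c0 /andP[ci cs]; apply: IHs cs; apply: is_config_fire.
Qed.

(* After its last firing a vertex keeps every chip it receives, and each
   neighbour fired later gives it at least one; lateness in [s] is a small
   index in [rev s]. *)
Lemma later_neighbours_le (c : 'cV[int]_n) (s : seq 'I_n) (v : 'I_n) :
  symmetric e -> is_config c -> legal_seq e c s -> v \in s ->
  (indeg (fun u w => e u w && (index u (rev s) < index w (rev s))%N) v)%:Z
    <= foldl (fire e) c s v 0.
Proof.
move=> sym_e c0; elim/last_ind: s => // s i IHs cs vs.
have c'0 := is_config_foldl_fire c0 cs v; move: cs c'0.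
rewrite legal_seq_rcons foldl_rcons rev_rcons => /andP[cs _] c'0.
(* If [v] itself fires last, no neighbour is later. Otherwise all other indices shift by one and
   only [i] can become a new later neighbour; its firing has just given [v] a chip. *)
rewrite /indeg /=; have [iv|iv] := eqVneq i v.
  by rewrite big1 // => u _; rewrite ltn0 andbF.
move: vs; rewrite mem_rcons inE eq_sym (negPf iv) /= => /(IHs cs) le_v.
rewrite fireE mxE eq_sym (negPf iv).
set later := fun u w => e u w && (index u (rev s) < index w (rev s))%N in le_v.
apply: (@le_trans _ _ ((indeg later v)%:Z + (e v i)%:Z)); last first.
  by move: le_v; case: (e v i); lia.
rewrite -PoszD lez_nat.
have -> : nat_of_bool (e v i) = (\sum_(u : 'I_n) ((u == i) * e v i))%N.
  rewrite (bigD1 i) //= eqxx mul1n big1 ?addn0 // => u /negPf ->.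
  by rewrite mul0n.
rewrite -big_split /=; apply: leq_sum => u _.
have [<-|ui] := eqVneq i u; first by rewrite ?eqxx (sym_e i v); case: (e v i) => /=; lia.
by rewrite ltnS leq_addr.
Qed.

(** A vertex that never fires only gains chips, so returning to [c] forbids its neighbours to fire
    as well. By connectedness nothing would fire. *)
Lemma mem_returning_seq (c : 'cV[int]_n) (s : seq 'I_n) :
  (forall x y, connect e x y) -> s <> [::] -> foldl (fire e) c s = c ->
  forall v, v \in s.
Proof.
move=> conn s0 fix_c.
have closed0 x y : e x y -> x \notin s -> y \notin s.
  move=> exy xs; apply/negP => ys; have := congr1 (fun d : 'cV_n => d x 0) fix_c.
  rewrite foldl_fireE => sum_eq.
  have {sum_eq} : \sum_(i <- s) laplacian e x i = 0 by lia.
  have /negPf xy : x != y by apply: contraNneq xs => ->.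
  rewrite (big_rem y) //= mxE xy exy => sum1.
  suff : \sum_(i <- rem y s) laplacian e x i <= 0.
    by move: sum1; set S := bigop _ _ _; move: S => S; lia.
  rewrite big_seq; apply: sumr_le0 => i /mem_rem i_s; rewrite mxE.
  have /negPf -> : x != i by apply: contraNneq xs => ->.
  by case: (e x i).
move=> v; apply: contraT => vs; case: s s0 {fix_c} closed0 vs => // i s _ closed0 vs.
have /connectP[p ep def_i] := conn v i.
suff : last v p \notin i :: s by rewrite -def_i mem_head.
elim: p v ep vs {def_i} => //= y p IHp v /andP[evy ep] vs.
by apply: IHp => //; apply: closed0 vs.
Qed.

(** Every vertex occurs in [s], so the last firing times exist and are pairwise distinct; comparing
    them directs every edge. *)
Lemma self_reachable_orientation (c : 'cV[int]_n) :
  is_tree e -> self_reachable e c ->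
  exists2 O, orientation O & forall v, (indeg O v)%:Z <= c v 0.
Proof.
move=> [sym_e irr_e conn _] [c0 [s [s0 cs fix_c]]].
have all_s := mem_returning_seq conn s0 fix_c.
exists (fun u w => e u w && (index u (rev s) < index w (rev s))%N); last first.
  by move=> v; rewrite -[in X in _ <= X]fix_c; apply: later_neighbours_le.
move=> u w; rewrite [e w u]sym_e; case euw: (e u w) => //=.
suff : index u (rev s) != index w (rev s) by lia.
apply/eqP => eq_i; suff uw : u = w by rewrite uw irr_e in euw.
by rewrite -[u](nth_index u (s := rev s)) ?mem_rev // eq_i nth_index ?mem_rev.
Qed.

(** * Firing along an acyclic orientation *)

Definition height (O : rel 'I_n) (v : 'I_n) : nat := #|[pred u | connect O u v]|.

(** Whatever reaches [u] reaches [w], while [w] cannot reach [u]: a directed path back would close a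
    cycle. *)
Lemma height_lt (O : rel 'I_n) (u w : 'I_n) :
  is_tree e -> orientation O -> O u w -> (height O u < height O w)%N.
Proof.
move=> [sym_e irr_e _ acyc] orO Ouw; apply: proper_card; apply/properP; split.
  apply/fintype.subsetP => x; rewrite !inE => /connect_trans; apply; exact: connect1.
exists w; rewrite !inE ?connect0 //; apply/negP => /connectP[p0 Op0 def_u].
have sub_e x y : O x y -> e x y by move: (orO x y); case: (O x y); case: (e x y).
move: def_u; case/shortenP: Op0 => p Op uniq_p _ def_u.
apply: (acyc (w :: p)); last first.
  rewrite /ucycle uniq_p andbT /= rcons_path -def_u sub_e // andbT.
  by apply: sub_path Op.
(* Cycles of size one and two are not excluded by the tree; they would be a loop and an edge with
   both directions. *)
case: p Op uniq_p def_u => [|x [|y p]] //=.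
  by move=> _ _ uw; move: Ouw (orO u w); rewrite uw irr_e => ->.
by rewrite andbT => Owx _ ux; move: Ouw (orO u w); rewrite ux Owx => ->; case: (e _ _).
Qed.

(** Fire each vertex once by decreasing height. At its turn a vertex holds its in-degree plus one
    chip from each out-neighbour, which makes its degree. The configuration returns because the rows
    of the Laplacian sum to zero. *)
Lemma orientation_self_reachable (O : rel 'I_n) (c : 'cV[int]_n) :
  (0 < n)%N -> is_tree e -> orientation O ->
  (forall v, (indeg O v)%:Z <= c v 0) -> self_reachable e c.
Proof.
move=> n0 tree_e orO le_c; have [sym_e irr_e conn acyc] := tree_e.
have c0 : is_config c by move=> v; apply: le_trans (le_c v).
split=> //.
pose s := sort (fun u w => height O w <= height O u)%N (enum 'I_n).
have mem_s v : v \in s by rewrite mem_sort mem_enum.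
have uniq_s : uniq s by rewrite sort_uniq enum_uniq.
have sorted_s : sorted (fun u w => height O w <= height O u)%N s.
  by apply: sort_sorted => x y; apply: leq_total.
exists s; split.
- by move=> s0; have := mem_s (Ordinal n0); rewrite s0.
- suff legal_pre s1 s2 : s = s1 ++ s2 -> legal_seq e c s1.
    by apply: (legal_pre s [::]); rewrite cats0.
  elim/last_ind: s1 s2 => // s1 i IHs1 s2 def_s.
  rewrite legal_seq_rcons (IHs1 (i :: s2)) -?cat_rcons //= /legal foldl_fireE.
  have is1 : i \notin s1.
    by move: uniq_s; rewrite def_s cat_uniq rcons_uniq -!andbA => /and3P[].
  have us1 : uniq s1.
    by move: uniq_s; rewrite def_s cat_uniq rcons_uniq -!andbA => /and3P[].
  have -> : \sum_(j <- s1) laplacian e i j = - (\sum_(j <- s1) e i j)%N%:Z.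
    rewrite -natz natr_sum -sumrN big_seq [RHS]big_seq; apply: eq_bigr => j js.
    have /negPf ij : i != j by apply: contraNneq is1 => ->.
    by rewrite mxE ij; case: (e i j).
  have : (deg e i <= indeg O i + \sum_(j <- s1) e i j)%N; last by have := le_c i; lia.
  rewrite degE (big_uniq _ us1) /= [X in (_ <= _ + X)%N]big_mkcond /indeg.
  rewrite -big_split /=.
  apply: leq_sum => j _; rewrite -orO addnC leq_add2l.
  case Oij : (O i j) => //.
  case js1 : (j \in s1); first by move: (orO i j); rewrite Oij; lia.
  (* An out-neighbour [j] not yet fired would come after [i] in [s], although its height is
     larger. *)
  have : j \in s2.
    have := mem_s j; rewrite def_s mem_cat mem_rcons inE js1 -?orbA /=.
    by case/orP => // /eqP ji; move: Oij (orO i j); rewrite ji irr_e => ->.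
  move=> js2; have := height_lt tree_e orO Oij.
  move: sorted_s; rewrite def_s sorted_pairwise; last first.
    by move=> x y z xy yz; apply: leq_trans yz xy.
  rewrite pairwise_cat => /and3P[/allrelP/(_ i j)]; rewrite mem_rcons mem_head.
  by move/(_ isT js2); rewrite leqNgt => /negP.
- apply/colP => j; rewrite foldl_fireE.
  suff -> : \sum_(i <- s) laplacian e j i = 0 by rewrite subr0.
  have ps : perm_eq s (enum 'I_n) by rewrite perm_sort.
  rewrite (perm_big _ ps) big_enum /= (bigD1 j) //= mxE eqxx degE.
  rewrite (bigD1 j) //= irr_e add0n -natz natr_sum -big_split /= big1 // => i ij.
  by rewrite mxE eq_sym (negPf ij); case: (e j i).
Qed.

(** * Total in-degree of an orientation *)

(** The right-hand side does not mention [O], so all orientations have the same total in-degree. *)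
Lemma sum_edges (O : rel 'I_n) : orientation O ->
  ((\sum_v indeg O v).*2 = \sum_v \sum_u e u v)%N.
Proof.
move=> orO; rewrite -addnn [X in (X + _)%N]exchange_big -big_split /=.
by apply: eq_bigr => v _; rewrite -big_split /=; apply: eq_bigr => u _; rewrite addnC orO.
Qed.

(** The tree with [w] deleted: the parent of [w] is its neighbour that stays connected to the
    root. *)
Definition avoiding (w : 'I_n) : rel 'I_n :=
  [rel x y | [&& e x y, x != w & y != w]].

Lemma connect_avoiding (w x : 'I_n) (p : seq 'I_n) :
  path e x p -> w \notin x :: p -> connect (avoiding w) x (last x p).
Proof.
move=> ep wp; apply/connectP; exists p => //.
apply: (@sub_in_path _ (predC1 w) e) ep.
  by move=> y z; rewrite !inE /avoiding /= => -> -> ->.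
by apply/allP => y yp; apply: contraNneq wp => <-.
Qed.

(* Orienting every edge away from a root [r], all in-degrees are at most one
   and that of [r] is zero. *)
Lemma sum_indeg_lt (O : rel 'I_n) :
  (0 < n)%N -> is_tree e -> orientation O -> (\sum_v indeg O v < n)%N.
Proof.
move=> n0 [sym_e irr_e conn acyc] orO; pose r := Ordinal n0.
pose D u w := [&& e u w, r != w & connect (avoiding w) r u].
(* Take a simple path from [r] to [u]. If it misses [w], then [D u w]; if not, its part up to [w]
   misses [u], and [D w u]. *)
have coverD u w : (e u w <= D u w + D w u)%N.
  case euw: (e u w) => //=.
  have uw : u != w by apply: contraTneq euw => ->; rewrite irr_e.
  have /connectP[p0 ep0 def_u] := conn r u.
  move: def_u; case/shortenP: ep0 => p ep uniq_p _ def_u.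
  have [wp|wp] := boolP (w \in r :: p); last first.
    have -> : D u w = true; last by [].
    rewrite /D euw def_u connect_avoiding // andbT.
    by apply: contraNneq wp => <-; rewrite mem_head.
  have -> : D w u = true; last by rewrite addn1.
  case/splitPl: wp ep uniq_p def_u => p1 p2 def_w.
  rewrite cat_path -cat_cons cat_uniq last_cat def_w.
  move=> /andP[ep1 ep2] /and3P[_ /hasPn up _] def_u.
  have u_p2 : u \in p2.
    by move: uw; rewrite def_u; case: (p2) => [|y q] /=; rewrite ?eqxx ?mem_last.
  have up1 : u \notin r :: p1 by apply: up.
  rewrite /D sym_e euw -def_w connect_avoiding // andbT /=.
  by apply: contraNneq up1 => ->; rewrite mem_head.
(* Two parents of [w] would be joined by a path outside [w], closing a cycle through [w]. *)
have injD u u' w : D u w -> D u' w -> u = u'.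
  move=> /and3P[euw _ ru] /and3P[eu'w _ ru'].
  have sym_a : symmetric (avoiding w).
    by move=> x y; rewrite /avoiding /= sym_e; do 2!case: (_ != w).
  have : connect (avoiding w) u u'.
    by rewrite (sym_connect_sym sym_a) in ru; apply: connect_trans ru ru'.
  case/connectP => p0 ep0 def_u'; apply/eqP/negPn/negP => uu'.
  move: def_u'; case/shortenP: ep0 => p ep uniq_p _ def_u'.
  have wp : w \notin u :: p.
    rewrite inE negb_or; apply/andP; split.
      by apply: contraTneq euw => <-; rewrite irr_e.
    elim: p u ep {uniq_p def_u' euw ru uu'} => //= y p IHp u /andP[/and3P[_ _ yw] ep].
    by rewrite inE negb_or eq_sym yw; apply: IHp ep.
  apply: (acyc [:: w, u & p]).
    by move: uu'; rewrite def_u'; case: (p) => //=; rewrite eqxx.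
  rewrite /ucycle [uniq _]/= wp -/(uniq (u :: p)) uniq_p andbT /=.
  rewrite sym_e euw rcons_path -def_u' eu'w andbT.
  by rewrite andbT; apply: sub_path ep => x y /and3P[].
have indegD w : (indeg D w <= (w != r))%N.
  have [/existsP[u Duw]|no_u] := boolP [exists u, D u w].
    rewrite /indeg (bigD1 u) //= big1 ?addn0 => [|x xu].
      by rewrite Duw; case/and3P: Duw => _ rw _; rewrite eq_sym rw.
    by apply/eqP; rewrite eqb0; apply: contraNN xu => Dxw; apply/eqP/(injD _ _ _ Dxw).
  rewrite /indeg big1 // => u _; apply/eqP; rewrite eqb0.
  by apply: contraNN no_u => Duw; apply/existsP; exists u.
have leD : (\sum_v indeg D v < n)%N.
  apply: (@leq_ltn_trans (\sum_(v : 'I_n) (v != r))%N).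
    by apply: leq_sum => w _; apply: indegD.
  rewrite (bigD1 r) //= ?add0n (eq_bigr (fun=> 1%N)) => [|v ->] //.
  by rewrite sum1_card cardC1 card_ord ltn_predL.
suff : ((\sum_v indeg O v).*2 <= (\sum_v indeg D v).*2)%N by lia.
rewrite sum_edges // -[leqRHS]addnn [X in (_ <= X + _)%N]exchange_big -big_split /=.
by apply: leq_sum => v _; rewrite -big_split /=; apply: leq_sum => u _; rewrite addnC.
Qed.

(** * Adding and removing single chips *)

Lemma basis_vecE (i j : 'I_n) : basis_vec i j 0 = (j == i)%:Z.
Proof. by rewrite mxE andbT natz. Qed.

Lemma add_basis_vecE (c : 'cV[int]_n) (i j : 'I_n) :
  (c + basis_vec i) j 0 = c j 0 + (j == i)%:Z.
Proof. by rewrite mxE basis_vecE. Qed.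

Lemma sub_basis_vecE (c : 'cV[int]_n) (i j : 'I_n) :
  (c - basis_vec i) j 0 = c j 0 - (j == i)%:Z.
Proof. by rewrite 2!mxE basis_vecE. Qed.

Lemma chips_basis_vec (i : 'I_n) : chips (basis_vec i) = 1.
Proof.
rewrite /chips (bigD1 i) //= basis_vecE eqxx big1 // => j /negPf ji.
by rewrite basis_vecE ji.
Qed.

Lemma chipsD (c d : 'cV[int]_n) : chips (c + d) = chips c + chips d.
Proof. by rewrite /chips -big_split; apply: eq_bigr => i _; rewrite mxE. Qed.

Lemma chipsB (c d : 'cV[int]_n) : chips (c - d) = chips c - chips d.
Proof. by rewrite /chips -sumrB; apply: eq_bigr => i _; rewrite !mxE. Qed.

Lemma self_reachableD (c : 'cV[int]_n) (i : 'I_n) :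
  (0 < n)%N -> is_tree e -> self_reachable e c ->
  self_reachable e (c + basis_vec i).
Proof.
move=> n0 tree_e /(self_reachable_orientation tree_e)[O orO le_c].
apply: orientation_self_reachable orO _ => // v.
by rewrite add_basis_vecE; have := le_c v; lia.
Qed.

Lemma self_reachableB_orientation (O : rel 'I_n) (c : 'cV[int]_n) (i : 'I_n) :
  (0 < n)%N -> is_tree e -> orientation O ->
  (forall v, (indeg O v)%:Z <= c v 0) -> (indeg O i)%:Z < c i 0 ->
  self_reachable e (c - basis_vec i).
Proof.
move=> n0 tree_e orO le_c lt_c; apply: orientation_self_reachable orO _ => // v.
by rewrite sub_basis_vecE; have := le_c v; case: eqVneq => [->|_]; lia.
Qed.

(** The in-degrees sum to less than [n], so some vertex holds a chip above its in-degree. *)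
Lemma self_reachable_extra (c : 'cV[int]_n) :
  (0 < n)%N -> is_tree e -> self_reachable e c -> n%:Z <= chips c ->
  exists i, self_reachable e (c - basis_vec i).
Proof.
move=> n0 tree_e /(self_reachable_orientation tree_e)[O orO le_c] le_n.
have [/existsP[i lt_i]|no_i] := boolP [exists i, (indeg O i)%:Z < c i 0].
  by exists i; apply: self_reachableB_orientation orO _ _.
suff : chips c <= (\sum_v indeg O v)%N%:Z.
  by have := sum_indeg_lt n0 tree_e orO; lia.
rewrite -[leRHS]natz natr_sum; apply: ler_sum => i _; rewrite natz leNgt.
by apply: contraNN no_i => lt_i; apply/existsP; exists i.
Qed.

(** * Edge reversal and near-minimal configurations *)

Definition reverse_edge (O : rel 'I_n) (v w : 'I_n) : rel 'I_n :=
  fun x y => if (x == v) && (y == w) then false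
             else if (x == w) && (y == v) then true else O x y.

Lemma orientation_reverse_edge (O : rel 'I_n) (v w : 'I_n) :
  irreflexive e -> orientation O -> O v w ->
  orientation (reverse_edge O v w).
Proof.
move=> irr_e orO Ovw x y; rewrite /reverse_edge -orO.
have vw : v != w.
  by apply: contraTneq Ovw => ->; move: (orO w w); rewrite irr_e; case: (O w w).
have Owv : O w v = false.
  by move: (orO v w); rewrite Ovw; case: (O w v); case: (e v w).
have neq z : (z == v) && (z == w) = false.
  by case: eqVneq => //= ->; rewrite (negPf vw).
have Oxy : (x == v) && (y == w) -> O x y && ~~ O y x.
  by case/andP => /eqP-> /eqP->; rewrite Ovw Owv.
have Oyx : (y == v) && (x == w) -> O y x && ~~ O x y.
  by case/andP => /eqP-> /eqP->; rewrite Ovw Owv.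
move: (neq x) (neq y) Oxy Oyx; case: (x == v); case: (x == w) => //=;
  case: (y == v); case: (y == w) => //= _ _; case: (O x y) => //=;
  case: (O y x) => //=; lia.
Qed.

(** One unit of in-degree moves from [w] to [v]; additions on both sides avoid truncated
    subtraction. *)
Lemma indeg_reverse_edge (O : rel 'I_n) (v w x : 'I_n) :
  O v w -> O w v = false -> v != w ->
  (indeg (reverse_edge O v w) x + (x == w) = indeg O x + (x == v))%N.
Proof.
move=> Ovw Owv vw; rewrite /indeg /reverse_edge.
have wv : w == v = false by rewrite eq_sym (negPf vw).
have [->|xw] := eqVneq x w.
  rewrite wv (bigD1 v) // [in RHS](bigD1 v) //= !eqxx Ovw.
  rewrite (eq_bigr (fun u => O u w : nat)) => [|u /negPf->]; first by rewrite /=; lia.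
  by rewrite andbF.
have [->|xv] := eqVneq x v.
  rewrite (bigD1 w) // [in RHS](bigD1 w) //= !eqxx wv Owv.
  rewrite (eq_bigr (fun u => O u v : nat)) => [|u /negPf->]; first by rewrite /=; lia.
  by rewrite andbF.
by congr (_ + _)%N; apply: eq_bigr => u _; rewrite !andbF.
Qed.

(* A chip above the in-degrees can be moved backwards along an edge by
   reversing that edge, so a unique removable chip sits on a sink. *)
Lemma near_minimal_orientation (c : 'cV[int]_n) :
  (0 < n)%N -> is_tree e -> near_minimally_self_reachable e c ->
  exists O v, [/\ orientation O, forall u, (indeg O u)%:Z <= c u 0,
    forall u, u != v -> c u 0 = indeg O u & forall u, ~~ O v u].
Proof.
move=> n0 tree_e [_ _ [v [SRv uniq_v]]].
have [O orO le_cv] := self_reachable_orientation tree_e SRv.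
have le_c u : (indeg O u)%:Z <= c u 0.
  by have := le_cv u; rewrite sub_basis_vecE; lia.
have lt_cv : (indeg O v)%:Z < c v 0.
  by have := le_cv v; rewrite sub_basis_vecE eqxx; lia.
exists O, v; split=> // [u uv|u].
  apply/eqP; rewrite eq_le le_c andbT leNgt; apply: contraNN uv => lt_u.
  by rewrite eq_sym; apply/eqP/uniq_v; apply: self_reachableB_orientation orO _ _.
apply/negP => Ovu; have [sym_e irr_e _ _] := tree_e.
have vu : v != u.
  by apply: contraTneq Ovu => ->; move: (orO u u); rewrite irr_e; case: (O u u).
have Ouv : O u v = false by move: (orO v u); rewrite Ovu; case: (O u v); case: (e v u).
have orO' := orientation_reverse_edge irr_e orO Ovu.
have indegO' x := indeg_reverse_edge x Ovu Ouv vu.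
(* After the reversal the extra chip at [v] covers its new incoming edge, and [u] has a chip to
   spare. *)
suff SRu : self_reachable e (c - basis_vec u) by move: vu; rewrite (uniq_v _ SRu) eqxx.
apply: self_reachableB_orientation orO' _ _ => // [x|].
  have := indegO' x; have := le_c x.
  by case: (eqVneq x v) => [->|]; case: (eqVneq _ u); lia.
by have := indegO' u; have := le_c u; rewrite eqxx eq_sym (negPf vu); lia.
Qed.

(** * Maximizing a linear functional *)

Lemma sum_weighted_indeg (A : 'I_n -> int) (O : rel 'I_n) :
  (\sum_w A w * (indeg O w)%:Z) *+ 2 =
  \sum_(p : 'I_n * 'I_n) (A p.2 * (O p.1 p.2)%:Z + A p.1 * (O p.2 p.1)%:Z).
Proof.
have E : \sum_w A w * (indeg O w)%:Z = \sum_w \sum_u A w * (O u w)%:Z.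
  apply: eq_bigr => w _; rewrite -[(indeg O w)%:Z]natz natr_sum mulr_sumr.
  by apply: eq_bigr => u _; rewrite natz.
rewrite mulr2n {2}E E [X in X + _]exchange_big -big_split /=.
rewrite -(pair_bigA _ (fun u w => A w * (O u w)%:Z + A u * (O w u)%:Z)) /=.
by apply: eq_bigr => u _; rewrite big_split.
Qed.

(** Each edge contributes the weight of its head, and [O] always picks the heavier endpoint.
    Equality of the sums forces the same choice on every edge. *)
Lemma weighted_indeg_max (A : 'I_n -> int) (O O' : rel 'I_n) :
  orientation O -> orientation O' -> (forall u w, O u w -> A u < A w) ->
  \sum_w A w * (indeg O' w)%:Z <= \sum_w A w * (indeg O w)%:Z /\
  (\sum_w A w * (indeg O' w)%:Z = \sum_w A w * (indeg O w)%:Z -> O' =2 O).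
Proof.
move=> orO orO' ltA.
pose F (Q : rel 'I_n) p := A p.2 * (Q p.1 p.2)%:Z + A p.1 * (Q p.2 p.1)%:Z.
have leF p : 0 <= F O p - F O' p /\ (F O p - F O' p = 0 -> O' p.1 p.2 = O p.1 p.2).
  case: p => u w; rewrite /F /=.
  move: (orO u w) (orO' u w) (ltA u w) (ltA w u).
  by case: (O u w); case: (O w u); case: (O' u w); case: (O' w u);
    case: (e u w) => //= _ _ ltuw ltwu; split=> //;
    try have := ltuw isT; try have := ltwu isT; lia.
have sumF : \sum_p (F O p - F O' p) =
    (\sum_w A w * (indeg O w)%:Z - \sum_w A w * (indeg O' w)%:Z) *+ 2.
  by rewrite mulrnBl !sum_weighted_indeg sumrB.
have leF0 p : true -> 0 <= F O p - F O' p by move=> _; case: (leF p).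
split=> [|eqW u w].
  by rewrite -subr_ge0 -(pmulrn_lge0 _ (ltn0Sn 1)) -sumF; apply: sumr_ge0.
move: sumF; rewrite eqW subrr mul0rn => /(psumr_eq0P leF0)/(_ (u, w) isT).
by case: (leF (u, w)).
Qed.

Lemma near_minimal_maximizer (c : 'cV[int]_n) :
  (0 < n)%N -> is_tree e -> near_minimally_self_reachable e c ->
  exists A : 'I_n -> int, forall d, self_reachable e d -> chips d = chips c ->
    \sum_i A i * d i 0 <= \sum_i A i * c i 0 /\
    (\sum_i A i * d i 0 = \sum_i A i * c i 0 -> d = c).
Proof.
move=> n0 tree_e /(near_minimal_orientation n0 tree_e)[O [v [orO le_c c_eq sink_v]]].
(* Heights are at most [n], so [n.+1] makes [v] strictly heaviest; [A] still increases along [O]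
   because [v] is a sink. *)
pose A i : int := if i == v then n.+1%:Z else (height O i)%:Z.
have A_lt u : u != v -> A u < A v.
  move=> /negPf uv; rewrite /A eqxx uv ltz_nat ltnS -[leqRHS]card_ord.
  exact: max_card.
have A_O u w : O u w -> A u < A w.
  move=> Ouw; have uv : u != v by apply: contraTneq Ouw => ->.
  have [->|wv] := eqVneq w v; first exact: A_lt.
  by rewrite /A (negPf uv) (negPf wv) ltz_nat; apply: height_lt orO Ouw.
exists A => d /(self_reachable_orientation tree_e)[O' orO' le_d] chips_d.
have [le_W eq_W] := weighted_indeg_max orO orO' A_O.
have eq_indeg : \sum_i (indeg O i)%:Z = \sum_i (indeg O' i)%:Z.
  have := sum_edges orO'; rewrite -(sum_edges orO) => /double_inj eqS.
  have toZ Q : \sum_i (indeg Q i)%:Z = (\sum_i indeg Q i)%N%:Z.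
    by rewrite -[RHS]natz natr_sum; apply: eq_bigr => i _; rewrite natz.
  by rewrite !toZ eqS.
have slack0 u : true -> 0 <= (A v - A u) * (d u 0 - (indeg O' u)%:Z).
  move=> _; apply: mulr_ge0; last by rewrite subr_ge0.
  by rewrite subr_ge0; have [->|/A_lt/ltW] := eqVneq u v.
(* The loss of [d] splits into two nonnegative parts: a worse orientation, and extra chips placed
   away from [v]. *)
have eq_val : \sum_i A i * c i 0 - \sum_i A i * d i 0 =
    (\sum_i A i * (indeg O i)%:Z - \sum_i A i * (indeg O' i)%:Z) +
    \sum_i (A v - A i) * (d i 0 - (indeg O' i)%:Z).
  have extra_c : \sum_i A i * c i 0 =
      \sum_i A i * (indeg O i)%:Z + A v * \sum_i (c i 0 - (indeg O i)%:Z).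
    rewrite mulr_sumr -big_split /=; apply: eq_bigr => i _.
    by have [->|/c_eq->] := eqVneq i v; lia.
  have extra_d : \sum_i (A v - A i) * (d i 0 - (indeg O' i)%:Z) =
      A v * \sum_i (d i 0 - (indeg O' i)%:Z) - \sum_i A i * d i 0 +
      \sum_i A i * (indeg O' i)%:Z.
    rewrite mulr_sumr -sumrB -big_split /=; apply: eq_bigr => i _.
    by lia.
  have eq_extra : \sum_i (c i 0 - (indeg O i)%:Z) = \sum_i (d i 0 - (indeg O' i)%:Z).
    by rewrite !sumrB eq_indeg; congr (_ - _); rewrite -/(chips c) -/(chips d).
  by rewrite extra_c extra_d eq_extra; ring.
have slack_ge0 := sumr_ge0 _ slack0.
split=> [|eq_dc]; first by rewrite -subr_ge0 eq_val addr_ge0 ?subr_ge0.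
have /eqP : \sum_i A i * (indeg O i)%:Z - \sum_i A i * (indeg O' i)%:Z +
    \sum_i (A v - A i) * (d i 0 - (indeg O' i)%:Z) = 0.
  by rewrite -eq_val eq_dc subrr.
(* Both parts vanish, so [d] agrees with [c] off [v]; the number of chips settles the value at
   [v]. *)
rewrite paddr_eq0 ?subr_ge0 // => /andP[/eqP W0 /eqP/(psumr_eq0P slack0) slack_eq].
have {}eq_W : O' =2 O by apply: eq_W; apply/esym/subr0_eq.
have eq_d u : u != v -> d u 0 = c u 0.
  move=> uv; have /eqP := slack_eq u isT; rewrite mulf_eq0 subr_eq0.
  rewrite gt_eqF ?A_lt //= subr_eq0 => /eqP->; rewrite (c_eq u uv).
  by congr Posz; apply: eq_bigr => w _; rewrite eq_W.
apply/colP => u; have [->|/eq_d//] := eqVneq u v.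
move: chips_d; rewrite /chips (bigD1 v) //= [in RHS](bigD1 v) //=.
by rewrite (eq_bigr (fun i => c i 0)) => [/addIr|i /eq_d].
Qed.

End Firing.

(** * Linear functionals on convex hulls *)

Section ConvexHull.

Variables (R : realType) (n : nat).
Implicit Types (S : set 'cV[R]_n) (a : 'rV[R]_n).

Lemma sub_conv_hull S : S `<=` conv_hull S.
Proof.
move=> x Sx; exists 1%N, (fun=> 1), (fun=> x).
by split=> //; rewrite big_ord_recl big_ord0 ?addr0 ?scale1r.
Qed.

Lemma mulmx_convex k a (w : 'I_k -> R) (p : 'I_k -> 'cV[R]_n) :
  (a *m \sum_i w i *: p i) 0 0 = \sum_i w i * (a *m p i) 0 0.
Proof.
rewrite mulmx_sumr summxE; apply: eq_bigr => i _.
by rewrite -scalemxAr mxE.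
Qed.

Lemma conv_hull_le S a b :
  (forall x, S x -> (a *m x) 0 0 <= b) ->
  forall x, conv_hull S x -> (a *m x) 0 0 <= b.
Proof.
move=> le_b x [k [w [p [w0 w1 Sp ->]]]]; rewrite mulmx_convex.
rewrite -[leRHS]mul1r -w1 mulr_suml; apply: ler_sum => i _.
by rewrite ler_wpM2l ?le_b.
Qed.

(** The weighted gaps to [b] are nonnegative and sum to zero, so each of them is zero. *)
Lemma convex_combination_tight k a b (w : 'I_k -> R) (p : 'I_k -> 'cV[R]_n) :
  (forall i, 0 <= w i) -> \sum_i w i = 1 -> (forall i, (a *m p i) 0 0 <= b) ->
  (a *m \sum_i w i *: p i) 0 0 = b ->
  forall i, w i != 0 -> (a *m p i) 0 0 = b.
Proof.
move=> w0 w1 le_b; rewrite mulmx_convex => eq_b i wi.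
have gap0 j : true -> 0 <= w j * (b - (a *m p j) 0 0).
  by move=> _; rewrite mulr_ge0 ?subr_ge0.
have : \sum_j w j * (b - (a *m p j) 0 0) = 0.
  under eq_bigr do rewrite mulrBr.
  by rewrite sumrB -mulr_suml w1 mul1r eq_b subrr.
move/(psumr_eq0P gap0)/(_ i isT)/eqP; rewrite mulf_eq0 (negPf wi) subr_eq0.
by move/eqP.
Qed.

End ConvexHull.

(** * Vertices of the polytope *)

Lemma real_config_inj (R : realType) (n : nat) : injective (@real_config R n).
Proof.
move=> c d /colP eq_cd; apply/colP => i.
by have := eq_cd i; rewrite !mxE => /intr_inj.
Qed.

Lemma mulmx_real_config (R : realType) (n : nat) (A : 'I_n -> int)
    (c : 'cV[int]_n) :
  ((\row_i (A i)%:~R : 'rV[R]_n) *m real_config R c) 0 0 =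
  (\sum_i A i * c i 0)%:~R.
Proof.
by rewrite mxE rmorph_sum; apply: eq_bigr => i _; rewrite !mxE rmorphM.
Qed.

Lemma vertex_near_minimal (R : realType) (n : nat) (e : rel 'I_n) (l : int)
    (x : 'cV[R]_n) :
  (0 < n)%N -> is_tree e -> n%:Z <= l ->
  vertices (self_reachable_polytope R e l) x ->
  exists2 nu, near_minimally_self_reachable e nu /\ chips nu = l &
    real_config R nu = x.
Proof.
move=> n0 tree_e le_nl [a [b [valid face]]].
have memF y : self_reachable_polytope R e l y -> (a *m y) 0 0 = b -> y = x.
  by move=> Py ay; have : [set x] y by rewrite face.
have [Px ax] : (self_reachable_polytope R e l `&` [set y | (a *m y) 0 0 = b]) x.
  by rewrite -face.
have memP c : self_reachable e c -> chips c = l ->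
    self_reachable_polytope R e l (real_config R c).
  by move=> SRc lc; apply: sub_conv_hull; exists c.
have [k [w [p [w0 w1 Sp def_x]]]] := Px.
(* A generator with nonzero weight lies on the same face as [x], hence is [x]; so [x] is a
   configuration. *)
have [i wi] : exists i, w i != 0.
  apply/existsP; apply: contraT; rewrite negb_exists => /forallP w_eq0.
  have : \sum_i w i = 0 by apply: big1 => i _; apply/eqP/negPn/w_eq0.
  by rewrite w1 => /eqP; rewrite oner_eq0.
have Pp j : self_reachable_polytope R e l (p j) by apply: sub_conv_hull.
have ap : (a *m p i) 0 0 = b.
  apply: (convex_combination_tight w0 w1 _ _ wi) => [j|]; first exact: valid.
  by rewrite -def_x.
have px := memF _ (Pp i) ap.
have [nu [SRnu chips_nu] nu_p] := Sp i.
have nu_x : real_config R nu = x by rewrite nu_p.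
exists nu => //; split=> //; split=> // [[_ min_nu]|].
  by move: le_nl; rewrite -chips_nu min_nu; lia.
have [j SRj] : exists j, self_reachable e (nu - basis_vec j).
  by apply: self_reachable_extra => //; rewrite chips_nu.
exists j; split=> // j' SRj'; apply/eqP/negPn/negP => jj'.
(* With two removable chips, moving one to the place of the other gives two points with midpoint
   [x], both then on the face. *)
pose c1 := nu - basis_vec j + basis_vec j'.
pose c2 := nu - basis_vec j' + basis_vec j.
have chips_move i1 i2 : chips (nu - basis_vec i1 + basis_vec i2) = l.
  by rewrite chipsD chipsB !chips_basis_vec subrK.
have P1 : self_reachable_polytope R e l (real_config R c1).
  by apply: memP (chips_move _ _); apply: self_reachableD.
have P2 : self_reachable_polytope R e l (real_config R c2).
  by apply: memP (chips_move _ _); apply: self_reachableD.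
have mid : real_config R c1 + real_config R c2 = x + x.
  rewrite -nu_x -!map_mxD; congr map_mx; rewrite /c1 /c2.
  by apply/matrixP => r s; rewrite !mxE; ring.
have ac1 : (a *m real_config R c1) 0 0 = b.
  have := congr1 (fun y => (a *m y) 0 0) mid; rewrite /= !mulmxDr.
  rewrite [LHS]mxE [RHS]mxE ax.
  by have := valid _ P1; have := valid _ P2; lra.
have /real_config_inj/colP/(_ j) : real_config R c1 = real_config R nu.
  by rewrite nu_x; apply: memF.
by rewrite /c1 add_basis_vecE sub_basis_vecE eqxx (negPf jj'); lia.
Qed.

Lemma near_minimal_vertex (R : realType) (n : nat) (e : rel 'I_n)
    (nu : 'cV[int]_n) :
  (0 < n)%N -> is_tree e -> near_minimally_self_reachable e nu ->
  vertices (self_reachable_polytope R e (chips nu)) (real_config R nu).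
Proof.
move=> n0 tree_e min_nu.
have [A A_max] := near_minimal_maximizer n0 tree_e min_nu.
have [SRnu _ _] := min_nu.
pose a : 'rV[R]_n := \row_i (A i)%:~R.
pose b : R := (\sum_i A i * nu i 0)%:~R.
have valid y : (real_config R @` self_reachable_with e (chips nu)) y ->
    (a *m y) 0 0 <= b.
  case=> d [SRd chips_d] <-; rewrite mulmx_real_config ler_int.
  by case: (A_max d SRd chips_d).
exists a, b; split; first exact: conv_hull_le.
apply/seteqP; split=> [_ ->|x [[k [w [p [w0 w1 Sp ->]]]] ab]] /=.
  by split; [apply: sub_conv_hull; exists nu | rewrite /= mulmx_real_config].
(* A generator with nonzero weight attains the maximum, which only [nu] does. *)
have p_nu i : w i *: p i = w i *: real_config R nu.
  have [->|wi] := eqVneq (w i) 0; first by rewrite !scale0r.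
  congr (_ *: _); have [d [SRd chips_d] def_p] := Sp i.
  have := convex_combination_tight w0 w1 (fun j => valid _ (Sp j)) ab wi.
  rewrite -def_p mulmx_real_config => /intr_inj eq_d.
  by have [_ ->] := A_max d SRd chips_d.
by under eq_bigr do rewrite p_nu; rewrite -scaler_suml w1 scale1r.
Qed.

Theorem theorem5p3 (R : realType) (n : nat) (e : rel 'I_n) (l : int) :
  (1 <= n)%N -> is_tree e -> n%:Z <= l ->
  vertices (self_reachable_polytope R e l) =
  real_config R @`
    [set nu | near_minimally_self_reachable e nu /\ chips nu = l].
Proof.
move=> n0 tree_e le_nl; apply/seteqP; split=> x /=.
  by move/(vertex_near_minimal n0 tree_e le_nl).
by case=> nu [min_nu <-] <-; apply: near_minimal_vertex.
Qed.
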